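(* Let $n\ge 1$, let $A_1,\dots,A_d\in\mathfrak{gl}(n)$ ($d\ge1$), and let $E_{i_1j_1},\dots,E_{i_ej_e}$ be elements of the standard basis $\{E_{ij}:1\le i,j\le n\}$ of $\mathfrak{gl}(n)$. Let $\mathcal G_{\rm drift}$ be the directed graph on $\mathrm V=\{1,\dots,n\}$ with an arc $(i,j)$ iff $[A_s]_{ij}\neq0$ for some $s$ (arcs $(i,i)$ are self-loops), and let $\mathcal G_{\rm contr}$ be the directed graph on $\mathrm V$ with arc set $\{(i_1,j_1),\dots,(i_e,j_e)\}$. Suppose that (i) each weakly connected component of $\mathcal G_{\rm contr}$ is strongly connected with at least two nodes; (ii) the union digraph $\mathcal G_{\rm drift}\cup\mathcal G_{\rm contr}$ is strongly connected; (iii) $\mathcal G_{\rm contr}$ has at least one self-loop. Then the system $\dot X=\mathsf B_0X+(\sum_{i=1}^m u_i\mathsf B_i)X$ is structurally accessible on $\mathrm{GL}^+(n)$ with respect to the pair of zero patterns $\big(\Sigma_{\rm r}(\{A_1,\dots,A_d\}),\Sigma_{\rm f}(\{E_{i_1j_1},\dots,E_{i_ej_e}\})\big)$.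
   Context: $E_{ij}$ is the $n\times n$ matrix with $(i,j)$ entry $1$ and others $0$; $\mathrm{GL}^+(n)$ is the identity component of the group of real invertible $n\times n$ matrices, with Lie algebra $\mathfrak{gl}(n)$ of all real $n\times n$ matrices. For a finite subset $\{g_1,\dots,g_k\}$ of a real Lie algebra, $\Sigma_{\rm f}(\{g_s\})=\{\sum l_sg_s:l_s\in\mathbb R\}$ and $\Sigma_{\rm r}(\{g_s\})=\{\sum l_sg_s: l_s\in\mathbb R, l_s\neq0\ \forall s\}$. For the system $\dot X=\mathsf B_0X+(\sum_{i=1}^m u_i\mathsf B_i)X$ on a connected matrix Lie group $\mathbf G$ (with $\mathsf B_i$ in its Lie algebra, controls piecewise continuous and real), $\mathcal R(I)$ is the set of states reachable at some time $T\ge0$ from $X(0)=I$; the system is accessible if $\mathcal R(I)$ has an interior point in $\mathbf G$. Structural accessibility w.r.t. $(\Sigma_{\rm r}(\mathfrak g_\alpha),\Sigma_{\rm f}(\mathfrak g_\beta))$ means: there exist $m\ge1$, $\mathsf B_0\in\Sigma_{\rm r}(\mathfrak g_\alpha)$, $\mathsf B_1,\dots,\mathsf B_m\in\Sigma_{\rm f}(\mathfrak g_\beta)$ making the system accessible. A weakly connected component of a digraph is a connected component when arc directions are ignored; a digraph is strongly connected if every two nodes are mutually reachable by directed paths. *)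

(* Defs.v *)
From HB Require Import structures.
From mathcomp Require Import all_boot all_order all_algebra.
From mathcomp Require Import all_classical all_reals all_analysis.
Set Implicit Arguments. Unset Strict Implicit. Unset Printing Implicit Defensive.
Import Order.TTheory GRing.Theory Num.Theory.
Import numFieldNormedType.Exports.
Local Open Scope classical_set_scope.
Local Open Scope ring_scope.

Section Defs.
Variable R : realType.

(* Sigma_f(S) : all real linear combinations of the elements of the finite set S
   (S given as a list; duplicates are irrelevant since we sum over undup S). *)
Definition sigma_f n (S : seq 'M[R]_n) (M : 'M[R]_n) : Prop :=
  exists l : 'M[R]_n -> R, M = \sum_(g <- undup S) l g *: g.

Definition sigma_r n (S : seq 'M[R]_n) (M : 'M[R]_n) : Prop :=
  exists l : 'M[R]_n -> R, (forall g, g \in S -> l g != 0) /\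
    M = \sum_(g <- undup S) l g *: g.

Definition GLplus n (X : 'M[R]_n) : Prop := 0 < \det X.

(* Piecewise continuous control on [0,T]: finitely many break points
   0 = t_0 < t_1 < ... < t_k = T, and on each open piece the control agrees
   with a function continuous on all of R (so one-sided limits exist). *)
Definition piecewise_continuous m (T : R) (u : R -> 'I_m -> R) : Prop :=
  exists p : seq R, path <%R 0 p /\ last 0 p = T /\
    forall ab, ab \in zip (0 :: p) p ->
      exists g : 'I_m -> R -> R, (forall k, continuous (g k)) /\
        forall t, ab.1 < t < ab.2 -> forall k, u t k = g k t.

Definition solution n m (B0 : 'M[R]_n) (B : 'I_m -> 'M[R]_n)
    (T : R) (u : R -> 'I_m -> R) (X : R -> 'M[R]_n) : Prop :=
  X 0 = 1%:M /\
  (forall i j, {within `[0, T], continuous (fun t => X t i j)}) /\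
  exists F : seq R, forall t, 0 < t < T -> t \notin F ->
    forall i j, is_derive t (1 : R) (fun s => X s i j)
      (((B0 + \sum_(k < m) u t k *: B k) *m X t) i j).

Definition reachable n m (B0 : 'M[R]_n) (B : 'I_m -> 'M[R]_n) (Y : 'M[R]_n) : Prop :=
  exists (T : R) (u : R -> 'I_m -> R) (X : R -> 'M[R]_n),
    0 <= T /\ piecewise_continuous T u /\ solution B0 B T u X /\ X T = Y.

(* Accessible: R(I) has an interior point in GL^+(n)
   (topology of GL^+(n) induced from R^{n x n}, entrywise sup-distance). *)
Definition accessible n m (B0 : 'M[R]_n) (B : 'I_m -> 'M[R]_n) : Prop :=
  exists (Y : 'M[R]_n) (eps : R), 0 < eps /\ GLplus Y /\
    forall Z : 'M[R]_n, (forall i j, `|Z i j - Y i j| < eps) -> GLplus Z ->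
      reachable B0 B Z.

Definition structurally_accessible n (Sa Sb : seq 'M[R]_n) : Prop :=
  exists (m : nat) (B0 : 'M[R]_n) (B : 'I_m -> 'M[R]_n),
    (0 < m)%N /\ sigma_r Sa B0 /\ (forall k, sigma_f Sb (B k)) /\ accessible B0 B.

End Defs.

Definition drift_graph (R : realType) n d (A : 'I_d -> 'M[R]_n) : rel 'I_n :=
  fun i j => [exists s, A s i j != 0].

Definition contr_graph n e (arcs : 'I_e -> 'I_n * 'I_n) : rel 'I_n :=
  fun i j => [exists k, arcs k == (i, j)].

Definition sym_rel (T : finType) (r : rel T) : rel T := fun i j => r i j || r j i.
Definition union_rel (T : finType) (r s : rel T) : rel T := fun i j => r i j || s i j.

Definition strongly_connected (T : finType) (r : rel T) : Prop :=
  forall i j, connect r i j.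

Definition weak_components_strong_ge2 (T : finType) (r : rel T) : Prop :=
  (forall i j, connect (sym_rel r) i j -> connect r i j) /\
  (forall i, exists j, j != i /\ connect (sym_rel r) i j).

Definition has_self_loop (T : finType) (r : rel T) : Prop := exists i, r i i.

(* Main.v *)
Require Import Defs.
From HB Require Import structures.
From mathcomp Require Import all_boot all_order all_algebra.
From mathcomp Require Import all_classical all_reals all_analysis.
From mathcomp Require Import ring lra.
Set Implicit Arguments.
Unset Strict Implicit.
Unset Printing Implicit Defensive.
Import Order.TTheory GRing.Theory Num.Theory.
Import numFieldNormedType.Exports.
Local Open Scope ring_scope.
Local Open Scope classical_set_scope.

(** Take all control arcs [E_ij] as control matrices and a drift [B0] whose zero
pattern is exactly the drift graph (a generic combination of the [A_s]).

The matrices [B0] and [E_ij] generate [gl(n)] as a Lie algebra: at a node [z]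
with a self-loop, [ad E_zz] isolates the off-diagonal part of row [z] of any
element, so that [E_zj] can be propagated along the arcs of the union graph from
[z] to every node [j]; leaving a drift arc, the entry at [j] is separated from
the rest of the row by bracketing with a control arc [j -> k] and coming back
from [k] to [j] inside the control component of [j]. Transposition gives [E_jz],
and brackets of these give everything.

Accessibility follows from the rank condition by piecewise constant controls.
The endpoint is a product of exponentials [exp (t_i M_i)]; translated back to
the identity, its partial derivatives are the conjugates of [M_i] by the earlier
factors. A matrix orthogonal (for the trace form) to all such conjugates for all
words lies in a space stable under the generated Lie algebra, hence vanishes; so
some word has a surjective differential, and Banach's fixed point theorem shows
that the endpoint map covers a neighbourhood. *)

(** * Generation of [gl(n)] from a drift and elementary matrices *)

Section LieAlgebra.
Context {F : numFieldType} {n : nat}.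
Implicit Types (A B M : 'M[F]_n) (i j k z : 'I_n) (c : rel 'I_n).

Definition comm_bracket A B : 'M[F]_n := A *m B - B *m A.

(** Lie subalgebras are encoded as predicates because the one used for the rank condition is defined
    by quantifying over annihilating matrices and words. *)
Record lie_closed (L : 'M[F]_n -> Prop) : Prop := LieClosed {
  lie_add : forall A B, L A -> L B -> L (A + B);
  lie_scale : forall a A, L A -> L (a *: A);
  lie_bracket : forall A B, L A -> L B -> L (comm_bracket A B) }.

Lemma delta_mx_mulE z i M k l : (delta_mx z i *m M) k l = (k == z)%:R * M i l.
Proof.
rewrite mxE (bigD1 i) //= mxE eqxx andbT big1 ?addr0// => j ji.
by rewrite mxE (negbTE ji) andbF mul0r.
Qed.

Lemma mul_delta_mxE z i M k l : (M *m delta_mx z i) k l = M k z * (l == i)%:R.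
Proof.
rewrite mxE (bigD1 z) //= mxE eqxx big1 ?addr0// => j ji.
by rewrite mxE (negbTE ji) mulr0.
Qed.

Lemma comm_bracketE A B i j :
  comm_bracket A B i j = (A *m B) i j - (B *m A) i j.
Proof. by rewrite mxE [X in _ + X]mxE. Qed.

Lemma comm_bracket_delta i j k z :
  comm_bracket (delta_mx i j) (delta_mx k z) =
  (j == k)%:R *: delta_mx i z - (i == z)%:R *: delta_mx k j.
Proof.
apply/matrixP => a b; rewrite comm_bracketE !delta_mx_mulE !mxE.
by rewrite -!mulnb !natrM (eq_sym z); ring.
Qed.

Definition row_off_diag z M : 'M[F]_n :=
  \matrix_(i, j) (((i == z) && (j != z))%:R * M i j).

(* [ad E_zz] scales the entry (i, j) by (i == z) - (j == z), so the row part is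
   [(ad E_zz + (ad E_zz)^2) / 2]. *)
Lemma lie_row_off_diag L z M : lie_closed L -> L (delta_mx z z) -> L M ->
  L (row_off_diag z M).
Proof.
move=> [La Ls Lb] Lz LM; have L1 := Lb _ _ Lz LM; have L2 := Lb _ _ Lz L1.
suff -> : row_off_diag z M = 2^-1 *: (comm_bracket (delta_mx z z) M +
    comm_bracket (delta_mx z z) (comm_bracket (delta_mx z z) M)).
  by apply: Ls; apply: La.
apply/matrixP => i j; have two0 : (2 : F) != 0 by rewrite pnatr_eq0.
rewrite mxE [RHS]mxE [in RHS]mxE.
have adE B : comm_bracket (delta_mx z z) B i j =
    ((i == z)%:R - (j == z)%:R) * B i j.
  rewrite comm_bracketE delta_mx_mulE mul_delta_mxE.
  have [->|iz] := eqVneq i z; have [->|jz] := eqVneq j z;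
    by rewrite ?mulr1n ?mulr0n ?subrr ?subr0 ?sub0r ?mul1r ?mulr1 ?mul0r ?mulr0
      ?subrr ?subr0 ?sub0r ?mulN1r.
rewrite !adE; have [->|iz] := eqVneq i z; have [->|jz] := eqVneq j z => /=.
all: by rewrite ?mulr1n ?mulr0n; field.
Qed.

(** Along a duplicate-free path from [i] to [j], the first step cannot stay at [i]. *)
Lemma connect_out_arc (T : finType) (c : rel T) (i j : T) :
  i != j -> connect c i j -> exists2 k, k != i & c i k.
Proof.
move=> ij /connectP[p pc jE]; case/shortenP: pc jE => -[|k q] /= qc uq _ jE.
  by rewrite jE eqxx in ij.
exists k; last by case/andP: qc.
by apply/eqP => ki; move: uq; rewrite ki inE eqxx.
Qed.

(** The set of [j] with [E_zj] in [L] contains [z] and is closed under arcs of both graphs. A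
    control arc is crossed by [[E_zi, E_ij] = E_zj] for distinct [z], [i], [j]; a drift arc needs
    the isolation argument of [stepB]. *)
Lemma lie_delta_row L c B z : lie_closed L ->
  (forall i j, c i j -> L (delta_mx i j)) -> L B -> c z z ->
  (forall i j, connect c i j -> connect c j i) ->
  (forall i, exists2 k, i != k & connect c i k) ->
  (forall j, connect (fun i j => (B i j != 0) || c i j) z j) ->
  forall j, L (delta_mx z j).
Proof.
move=> LL Lc LB cz csym c2 conn.
have Lz := Lc _ _ cz; have [La Ls Lb] := LL.
have stepc i j : L (delta_mx z i) -> c i j -> L (delta_mx z j).
  move=> Li cij; have [->//|jz] := eqVneq j z.
  have [iz|iz] := eqVneq i z; first by apply: Lc; rewrite -iz.
  have := Lb _ _ Li (Lc _ _ cij).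
  by rewrite comm_bracket_delta eqxx scale1r (eq_sym z) (negbTE jz) scale0r subr0.
have stepcc i j : L (delta_mx z i) -> connect c i j -> L (delta_mx z j).
  move=> Li /connectP[p]; elim: p i Li => [|k p IH] i Li /=; first by move=> _ ->.
  by case/andP=> cik pk jE; apply: IH pk jE; apply: stepc cik.
have stepB i j : L (delta_mx z i) -> B i j != 0 -> L (delta_mx z j).
  move=> Li Bij; have [czj|nczj] := boolP (connect c z j); first exact: stepcc czj.
  have [<-//|ij] := eqVneq i j.
  have jz : j != z by apply/eqP => jz; rewrite jz connect0 in nczj.
  (* [v] is supported on row [z] and has a nonzero entry at [j]. It comes from [B] itself if
     [i = z], and otherwise from [[E_zi, B]], whose entry at [(z, j)] is [B i j]. *)
  have [v Lv [vzj v0]] : exists2 v, L v &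
      v z j != 0 /\ forall k l, k != z -> v k l = 0.
    have [iz|iz] := eqVneq i z.
      exists (row_off_diag z B); first exact: lie_row_off_diag.
      split=> [|k l kz]; rewrite mxE ?(negbTE kz) ?mul0r// eqxx jz mul1r.
      by rewrite -iz.
    exists (row_off_diag z (comm_bracket (delta_mx z i) B)).
      by apply: lie_row_off_diag => //; apply: Lb.
    split=> [|k l kz]; rewrite mxE ?(negbTE kz) ?mul0r// eqxx jz mul1r.
    rewrite comm_bracketE delta_mx_mulE mul_delta_mxE eqxx mul1r.
    by rewrite (eq_sym j) (negbTE ij) mulr0 subr0.
  have [j' jj' cjj'] := c2 j; have [k kj cjk] := connect_out_arc jj' cjj'.
  (* An arc from [j] to [z] would put [j] in the control component of [z], a case already
     settled. *)
  have kz : k != z.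
    by apply: contra nczj => /eqP <-; apply: csym; apply: connect1.
  apply: (stepcc k); last by apply: csym; apply: connect1.
  (* As row [k] of [v] vanishes, [E_jk v = 0], and [v E_jk] keeps only the entry [v z j]. *)
  have -> : delta_mx z k = (v z j)^-1 *: comm_bracket v (delta_mx j k).
    apply/matrixP => a b; rewrite mxE [RHS]mxE comm_bracketE.
    rewrite mul_delta_mxE delta_mx_mulE (v0 k)// mulr0 subr0.
    have [->|az] := eqVneq a z; last by rewrite (v0 a)// mul0r mulr0.
    by rewrite mulrA mulVf// mul1r.
  by apply: Ls; apply: Lb => //; apply: Lc.
have steps p i : L (delta_mx z i) ->
    path (fun i j => (B i j != 0) || c i j) i p -> L (delta_mx z (last i p)).
  elim: p i => [|k p IH] i Li //= /andP[/orP[Bik|cik] pk]; apply: IH pk.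
    exact: stepB Bik.
  exact: stepc cik.
by move=> j; have /connectP[p zp ->] := conn j; apply: steps.
Qed.

Lemma lie_full L c B z : lie_closed L ->
  (forall i j, c i j -> L (delta_mx i j)) -> L B -> c z z ->
  (forall i j, connect c i j -> connect c j i) ->
  (forall i, exists2 k, i != k & connect c i k) ->
  (forall i j, connect (fun i j => (B i j != 0) || c i j) i j) ->
  forall M, L M.
Proof.
move=> LL Lc LB cz csym c2 conn M; have [La Ls Lb] := LL.
have Lrow := @lie_delta_row L c B z LL Lc LB cz csym c2 (conn z).
have Lcol i : L (delta_mx i z).
  rewrite -[delta_mx i z]trmxK trmx_delta.
  (* Columns follow from rows applied to the transposed algebra, the reversed control graph and
     [B^T]. *)
  pose L' (A : 'M[F]_n) := L A^T; rewrite -/(L' _).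
  pose c' i j := c j i.
  have conn' i' j' : connect c' i' j' = connect c j' i' by rewrite connect_rev.
  apply: (@lie_delta_row L' c' B^T) => //.
  - split=> [A1 A2 LA1 LA2|a A1 LA1|A1 A2 LA1 LA2]; rewrite /L'.
    + by rewrite linearD; apply: La.
    + by rewrite linearZ; apply: Ls.
    + have -> : (comm_bracket A1 A2)^T = comm_bracket A2^T A1^T.
        by rewrite /comm_bracket linearB /= !trmx_mul.
      exact: Lb.
  - by move=> i' j' cij; rewrite /L' trmx_delta; apply: Lc.
  - by rewrite /L' trmxK.
  - by move=> i' j'; rewrite !conn'; exact: csym.
  - by move=> i'; have [k ik ck] := c2 i'; exists k => //; rewrite conn'; apply: csym.
  - move=> j; have := conn j z.
    rewrite -[X in is_true X -> _](connect_rev (fun i j => (B i j != 0) || c i j)).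
    by congr (is_true _); apply: eq_connect => a b /=; rewrite mxE.
(* Off the diagonal [E_ij = [E_iz, E_zj]]; on it, [[E_iz, E_zi] = E_ii - E_zz]. *)
have Ldelta i j : L (delta_mx i j).
  have [<-|ij] := eqVneq i j; last first.
    have := Lb _ _ (Lcol i) (Lrow j).
    by rewrite comm_bracket_delta eqxx scale1r (negbTE ij) scale0r subr0.
  have -> : delta_mx i i = comm_bracket (delta_mx i z) (delta_mx z i) + delta_mx z z.
    by rewrite comm_bracket_delta !eqxx !scale1r subrK.
  by apply: La; [apply: Lb|].
rewrite (matrix_sum_delta M).
have L0 : L 0 by rewrite -(scale0r (delta_mx z z)); exact: Ls.
by elim/big_ind: _ => // i _; elim/big_ind: _ => // j _; apply: Ls.
Qed.

End LieAlgebra.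

(** * Linear algebra: generic combinations and the trace form *)

Section GenericCombination.
Context {F : numFieldType}.

(** In characteristic zero the first [size q] naturals are distinct, too many to be all roots. *)
Lemma exists_nonroot (q : {poly F}) : q != 0 -> exists x, q.[x] != 0.
Proof.
move=> q0; apply/not_existsP => qr.
pose rs := [seq k%:R : F | k <- iota 0 (size q)].
have : (size rs < size q)%N.
  apply: max_poly_roots => //.
    by apply/allP => x _; apply/negP => /negP; apply: qr.
  rewrite map_inj_uniq ?iota_uniq// => a b /eqP.
  by rewrite eqr_nat => /eqP.
by rewrite size_map size_iota ltnn.
Qed.

(** With distinct powers of one unknown as coefficients, each entry of the sum is a polynomial in
    which distinct matrices cannot cancel; a common non-root of the nonzero ones gives the
    coefficients. *)
Lemma generic_combination m n (S : seq 'M[F]_(m, n)) :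
  exists l : 'M[F]_(m, n) -> F, (forall g, l g != 0) /\
    forall g i j, g \in S -> g i j != 0 ->
      (\sum_(h <- undup S) l h *: h) i j != 0.
Proof.
pose p i j := \sum_(h <- undup S) h i j *: 'X^(index h (undup S)) : {poly F}.
have pN0 g i j : g \in S -> g i j != 0 -> p i j != 0.
  move=> gS gij; apply: contraNN gij => /eqP p0.
  have := coef0 F (index g (undup S)); rewrite -p0 coef_sum.
  have gU : g \in undup S by rewrite mem_undup.
  rewrite (bigD1_seq g) ?undup_uniq//= coefZ coefXn eqxx mulr1.
  rewrite big_seq_cond big1 ?addr0; first by move=> ->.
  move=> h /andP[hU hg]; rewrite coefZ coefXn; case: eqP => [e|_]; last first.
    by rewrite mulr0.
  by have := nth_index h gU; rewrite e nth_index// => hE; rewrite hE eqxx in hg.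
(* The factor ['X] forces a nonzero [x], hence nonzero coefficients; entries that vanish identically
   are replaced by 1. *)
pose q : {poly F} := 'X * \prod_ij (if p ij.1 ij.2 == 0 then 1 else p ij.1 ij.2).
have q0 : q != 0.
  rewrite mulf_neq0 ?polyX_eq0//; apply/prodf_neq0 => ij _.
  by case: ifPn => // _; rewrite oner_eq0.
have [x] := exists_nonroot q0.
rewrite hornerM hornerX mulf_eq0 negb_or horner_prod => /andP[x0 /prodf_neq0 px].
exists (fun g => x ^+ index g (undup S)); split=> [g|g i j gS gij].
  by rewrite expf_neq0.
have := px (i, j) isT; rewrite (negbTE (pN0 g i j gS gij)) /= /p horner_sum.
rewrite summxE; congr (_ != 0); apply: eq_bigr => h _.
by rewrite hornerZ hornerXn mxE mulrC.
Qed.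

End GenericCombination.

(** Some entry of the projection along [U] onto a complement is a nonzero linear form vanishing on
    [U], and every linear form on matrices is a trace pairing. *)
Lemma exists_trace_annihilator (F : fieldType) n (U : {vspace 'M[F]_n}) :
  U != fullv ->
  exists2 D : 'M[F]_n, D != 0 & forall Y, Y \in U -> \tr (D *m Y) = 0.
Proof.
move=> Uf.
have [v vU] : exists v, v \notin U.
  apply/not_existsP => all; move/negP: Uf; apply; apply/eqP/vspaceP => v.
  by rewrite memvf; apply/negP => /negP; apply: all.
pose pr : 'End('M[F]_n) := (\1 - projv U)%VF.
have prE Y : pr Y = Y - projv U Y by rewrite !lfun_simp.
have prU Y : Y \in U -> pr Y = 0 by move=> YU; rewrite prE projv_id ?subrr.
have prv : pr v != 0.
  by apply: contra vU; rewrite prE subr_eq0 => /eqP ->; exact: memv_proj.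
have [i [j prij]] : exists i j, pr v i j != 0.
  apply/not_existsP => all; move/negP: prv; apply; apply/eqP/matrixP => i j.
  rewrite mxE; apply/eqP/negP => /negP h; apply: (all i); by exists j.
pose D : 'M[F]_n := \matrix_(a, b) pr (delta_mx b a) i j.
have DE Y : \tr (D *m Y) = pr Y i j.
  rewrite {2}(matrix_sum_delta Y) linear_sum summxE /mxtrace.
  under eq_bigr do rewrite mxE.
  rewrite exchange_big; apply: eq_bigr => a _; rewrite linear_sum summxE.
  by apply: eq_bigr => b _; rewrite linearZ !mxE mulrC.
exists D; last by move=> Y YU; rewrite DE prU// mxE.
by apply: contra prij => /eqP D0; rewrite -DE D0 mul0mx mxtrace0.
Qed.

(** * The matrix exponential as an entrywise power series *)

Section MatrixExponential.
Context {R : realType} {n : nat} (M : 'M[R]_n).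

Let pw k : 'M[R]_n := iter k (mulmx M) 1%:M.

Let pwC k : pw k *m M = M *m pw k.
Proof.
by elim: k => [|k IH]; rewrite /pw /= ?mul1mx ?mulmx1// -mulmxA -/(pw k) IH.
Qed.

Let normM : R := \sum_i \sum_j `|M i j|.

Let pw_bound k i j : `|pw k i j| <= normM ^+ k.
Proof.
elim: k i j => [|k IH] i j.
  by rewrite expr0 mxE; case: eqP => _; rewrite ?mulr1n ?mulr0n ?normr1 ?normr0.
rewrite /pw /= -/(pw k) mxE exprS (le_trans (ler_norm_sum _ _ _))//.
apply: (@le_trans _ _ ((\sum_l `|M i l|) * normM ^+ k)).
  rewrite mulr_suml; apply: ler_sum => l _; rewrite normrM.
  by rewrite ler_wpM2l.
rewrite ler_wpM2r ?exprn_ge0 ?sumr_ge0// => [a _|]; first exact: sumr_ge0.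
by rewrite [leRHS](bigD1 i)//= lerDl sumr_ge0// => a _; apply: sumr_ge0.
Qed.

(** Coefficients of the series for an entry of [A exp(tM)]. The prefactor [A] makes the family
    stable under termwise differentiation, which turns [A] into [A *m M]. *)
Let coef (A : 'M[R]_n) i j : R^nat := fun k => (A *m pw k) i j / k`!%:R.

(** The terms are dominated by a multiple of the real exponential series at [normM * |t|]. *)
Let cvg_coef A i j t : cvgn (pseries (coef A i j) t).
Proof.
apply: normed_cvg; pose a := \sum_l `|A i l|.
have a0 : 0 <= a by apply: sumr_ge0.
have b0 : 0 <= normM by apply: sumr_ge0 => ? _; apply: sumr_ge0.
apply: (@series_le_cvg _ _ (a *: exp_coeff (normM * `|t|))) => [k|k|k|].
- exact: normr_ge0.
- by rewrite mulr_ge0// exp_coeff_ge0// mulr_ge0.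
- rewrite /coef /= !normrM normrX normfV normr_nat fctE /exp_coeff /= exprMn.
  have -> : a *: (normM ^+ k * `|t| ^+ k / k`!%:R) =
      a * normM ^+ k / k`!%:R * `|t| ^+ k by rewrite -[LHS]/(_ * _); ring.
  rewrite ler_wpM2r ?exprn_ge0// ler_wpM2r ?invr_ge0//.
  rewrite mxE (le_trans (ler_norm_sum _ _ _))// /a mulr_suml.
  by apply: ler_sum => l _; rewrite normrM ler_wpM2l.
- exact/is_cvg_seriesZ/is_cvg_series_exp_coeff.
Qed.

Let diffs_coef A i j : pseries_diffs (coef A i j) = coef (A *m M) i j.
Proof.
apply/funext => k; rewrite /pseries_diffs /coef /pw /= -mulmxA factS natrM invfM.
by rewrite mulrCA mulVKf.
Qed.

Let lim_coef_sum (f : 'I_n -> R) (c : 'I_n -> R^nat) t :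
  (forall l, cvgn (pseries (c l) t)) ->
  limn (pseries (fun k => \sum_l f l * c l k) t) =
  \sum_l f l * limn (pseries (c l) t).
Proof.
move=> cc; apply: cvg_lim => //.
have -> : pseries (fun k => \sum_l f l * c l k) t =
    (fun N => \sum_l f l * pseries (c l) t N).
  apply/funext => N; rewrite /pseries /series /=.
  under eq_bigr do rewrite mulr_suml.
  rewrite exchange_big; apply: eq_bigr => l _; rewrite mulr_sumr.
  by apply: eq_bigr => k _; rewrite mulrA.
by apply: cvg_big => [|l _]; [exact: add_continuous|apply: cvgMl_tmp; exact: cc].
Qed.

Definition expmx (t : R) : 'M[R]_n := \matrix_(i, j) limn (pseries (coef 1%:M i j) t).

Let mul_expmx A t i j : (A *m expmx t) i j = limn (pseries (coef A i j) t).
Proof.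
have -> : coef A i j = fun k => \sum_l A i l * coef 1%:M l j k.
  apply/funext => k; rewrite /coef mxE mulr_suml; apply: eq_bigr => l _.
  by rewrite mul1mx mulrA.
rewrite lim_coef_sum// mxE; apply: eq_bigr => l _; by rewrite mxE.
Qed.

Lemma expmxC t : expmx t *m M = M *m expmx t.
Proof.
apply/matrixP => i j; rewrite mul_expmx.
have -> : coef M i j = fun k => \sum_l M l j * coef 1%:M i l k.
  apply/funext => k; rewrite /coef -pwC mxE mulr_suml; apply: eq_bigr => l _.
  by rewrite mul1mx mulrA [M l j * _]mulrC.
rewrite lim_coef_sum// mxE; apply: eq_bigr => l _; by rewrite mxE mulrC.
Qed.

Lemma expmx0 : expmx 0 = 1%:M.
Proof.
apply/matrixP => i j; rewrite mxE; apply: cvg_lim => //.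
apply: cvg_near_cst; near=> N; rewrite /pseries /series /=.
have N0 : (0 < N)%N by near: N; exists 1%N.
rewrite (big_cat_nat (n := 1))//= big_nat1 /coef expr0 mulr1 fact0 divr1 mul1mx.
by rewrite big_nat big1 ?addr0// => -[|k] // _; rewrite expr0n mulr0.
Unshelve. all: by end_near. Qed.

Lemma is_derive_expmx t i j :
  is_derive t (1 : R) (fun s => expmx s i j) ((M *m expmx t) i j).
Proof.
rewrite mul_expmx -[X in coef X]mul1mx -diffs_coef.
have -> : (fun s => expmx s i j) = fun s => limn (pseries (coef 1%:M i j) s).
  by apply/funext => s; rewrite mxE.
(* Termwise differentiation at [t] asks for convergence at some point of larger modulus. *)
apply: (@pseries_snd_diffs _ _ (`|t| + 1)); rewrite ?diffs_coef//.
by rewrite [ltRHS]ger0_norm ?ltrDl// addr_ge0.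
Qed.

End MatrixExponential.

(** * Derivatives of matrix curves and the group law of the exponential *)

Section MatrixDerivative.
Context {R : realType} {n : nat}.
Implicit Types X Y : R -> 'M[R]_n.

Definition mx_derive X t (dX : 'M[R]_n) :=
  forall i j, is_derive t (1 : R) (fun s => X s i j) (dX i j).

Lemma mx_deriveM X Y t dX dY : mx_derive X t dX -> mx_derive Y t dY ->
  mx_derive (fun s => X s *m Y s) t (dX *m Y t + X t *m dY).
Proof.
move=> hX hY i j.
have -> : (fun s => (X s *m Y s) i j) =
    \sum_l ((fun s => X s i l) * (fun s => Y s l j)).
  by apply/funext => s; rewrite mxE fct_sumE.
apply: is_derive_eq.
  by apply: is_derive_sum => l; apply: is_deriveM.
rewrite !mxE -big_split; apply: eq_bigr => l _ /=.
by rewrite addrC; congr (_ + _); exact: mulrC.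
Qed.

Lemma mx_derive_cst (A : 'M[R]_n) t : mx_derive (fun=> A) t 0.
Proof. by move=> i j; rewrite mxE; exact: is_derive_cst. Qed.

Lemma mx_derive_comp X (f : R -> R) t dX df :
  mx_derive X (f t) dX -> is_derive t (1 : R) f df ->
  mx_derive (fun s => X (f s)) t (df *: dX).
Proof.
move=> hX hf i j; rewrite mxE mulrC.
exact: (@is_derive1_comp _ (fun s => X s i j) f).
Qed.

Lemma mx_derive_expmx (M : 'M[R]_n) t : mx_derive (expmx M) t (M *m expmx M t).
Proof. by move=> i j; apply: is_derive_expmx. Qed.

Lemma mx_derive_0_cst X s t : (forall u, mx_derive X u 0) -> X s = X t.
Proof.
move=> hX; apply/matrixP => i j.
apply: (@is_derive_0_is_cst _ (fun u => X u i j)) => u.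
by have := hX u i j; rewrite mxE.
Qed.

Lemma mx_derive_expmxN (M : 'M[R]_n) t :
  mx_derive (fun s => expmx M (- s)) t (- (M *m expmx M (- t))).
Proof. by rewrite -scaleN1r; apply: mx_derive_comp; exact: mx_derive_expmx. Qed.

(** The left side has zero derivative in [t], so it equals its value at [t = 0]. *)
Lemma expmx_addN (M : 'M[R]_n) s t : expmx M (- t) *m expmx M (t + s) = expmx M s.
Proof.
pose X t := expmx M (- t) *m expmx M (t + s).
have -> : expmx M s = X 0 by rewrite /X oppr0 expmx0 mul1mx add0r.
rewrite -/(X t); apply: mx_derive_0_cst => u.
have dD : is_derive u (1 : R) (fun t : R => t + s) 1 by exact: is_derive_shift.
have := mx_deriveM (mx_derive_expmxN M u)
  (@mx_derive_comp _ (fun t => t + s) u _ _ (@mx_derive_expmx M (u + s)) dD).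
by rewrite scale1r mulNmx mulmxA expmxC addNr.
Qed.

Lemma expmxNM (M : 'M[R]_n) t : expmx M (- t) *m expmx M t = 1%:M.
Proof. by have := expmx_addN M 0 t; rewrite addr0 expmx0. Qed.

Lemma expmxMN (M : 'M[R]_n) t : expmx M t *m expmx M (- t) = 1%:M.
Proof. by rewrite -{1}[t]opprK expmxNM. Qed.

Lemma expmxD (M : 'M[R]_n) s t : expmx M (t + s) = expmx M t *m expmx M s.
Proof. by rewrite -(expmx_addN M s t) mulmxA expmxMN mul1mx. Qed.

(** It is the square of the nonzero determinant at [t / 2]. *)
Lemma det_expmx_gt0 (M : 'M[R]_n) t : 0 < \det (expmx M t).
Proof.
have /(congr1 determinant) := expmxNM M (t / 2).
rewrite det_mulmx det1 => detE; rewrite (splitr t) expmxD det_mulmx -expr2.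
rewrite lt_def sqr_ge0 andbT sqrf_eq0; apply/eqP => d0.
by move: detE; rewrite d0 mulr0 => /eqP; rewrite eq_sym oner_eq0.
Qed.

(** Durations are nonnegative, so trace identities along words are known on one side of 0 only. The
    Caratheodory quotient is continuous at 0 and vanishes at positive points, hence at 0. *)
Lemma derive_eq0_of_vanish_right (f : R -> R) (d : R) :
  is_derive (0 : R) (1 : R) f d -> (forall t, 0 <= t -> f t = 0) -> d = 0.
Proof.
move=> /is_derive1_caratheodory[g [fg cg <-]] f0; apply/eqP/negP => /negP g0.
have /cvgrPdist_lt/(_ `|g 0|) := cg; rewrite normr_gt0 => /(_ g0).
move=> /nbhs_ballP[e /= e0 /(_ (e / 2))].
rewrite /ball /= sub0r normrN gtr0_norm ?divr_gt0// ltr_pdivrMr// ltr_pMr//.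
rewrite ltr1n => /(_ isT).
suff -> : g (e / 2) = 0 by rewrite subr0 ltxx.
have e20 : e / 2 != 0 by rewrite lt0r_neq0// divr_gt0.
have := fg (e / 2); rewrite !f0// ?divr_ge0// ?ltW// !subr0 => /esym/eqP.
by rewrite mulf_eq0 (negbTE e20) orbF => /eqP.
Qed.

Lemma mxtrace_derive_eq0 (X : R -> 'M[R]_n) dX :
  mx_derive X 0 dX -> (forall t, 0 <= t -> \tr (X t) = 0) -> \tr dX = 0.
Proof.
move=> hX; apply: derive_eq0_of_vanish_right.
have -> : (fun t => \tr (X t)) = \sum_i (fun t => X t i i).
  by apply/funext => t; rewrite fct_sumE.
by apply: is_derive_sum => i; apply: hX.
Qed.

End MatrixDerivative.

(** * Control words and the rank condition *)

Section ControlWords.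
Context {R : realType} {n m : nat} (B0 : 'M[R]_n) (B : 'I_m -> 'M[R]_n).

Definition field_of (c : 'I_m -> R) : 'M[R]_n := B0 + \sum_(k < m) c k *: B k.

(* A word lists (constant control, duration) pairs, the most recent one first. *)
Definition word := seq (('I_m -> R) * R).

Definition positive_word (w : word) := all (fun a => 0 < a.2) w.

Fixpoint flow (w : word) : 'M[R]_n :=
  if w is a :: w' then expmx (field_of a.1) a.2 *m flow w' else 1%:M.

Fixpoint flow_inv (w : word) : 'M[R]_n :=
  if w is a :: w' then flow_inv w' *m expmx (field_of a.1) (- a.2) else 1%:M.

(* The partial derivatives of [flow w] with respect to the durations,
   translated back to the identity by left multiplication with [flow_inv w]. *)
Fixpoint flow_directions (w : word) : seq 'M[R]_n :=
  if w is a :: w' then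
    flow_inv w' *m field_of a.1 *m flow w' :: flow_directions w'
  else [::].

Lemma flow_cat w1 w2 : flow (w1 ++ w2) = flow w1 *m flow w2.
Proof. by elim: w1 => [|a w IH] /=; rewrite ?mul1mx// IH mulmxA. Qed.

Lemma flow_inv_cat w1 w2 : flow_inv (w1 ++ w2) = flow_inv w2 *m flow_inv w1.
Proof. by elim: w1 => [|a w IH] /=; rewrite ?mulmx1// IH mulmxA. Qed.

Lemma flowK w : flow_inv w *m flow w = 1%:M.
Proof.
elim: w => [|a w IH] /=; first by rewrite mulmx1.
by rewrite -mulmxA [X in _ *m X]mulmxA expmxNM mul1mx.
Qed.

Lemma flow_invK w : flow w *m flow_inv w = 1%:M.
Proof.
elim: w => [|a w IH] /=; first by rewrite mulmx1.
by rewrite -mulmxA [X in _ *m X]mulmxA IH mul1mx expmxMN.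
Qed.

Lemma det_flow_gt0 w : 0 < \det (flow w).
Proof.
elim: w => [|a w IH] /=; first by rewrite det1.
by rewrite det_mulmx mulr_gt0// det_expmx_gt0.
Qed.

Lemma flow_directions_suffix w1 w2 :
  {subset flow_directions w2 <= flow_directions (w1 ++ w2)}.
Proof. by elim: w1 => //= a w IH x xw; rewrite inE IH ?orbT. Qed.

(** By cyclicity of the trace, this is orthogonality of [D] to all conjugates of the fields by flows
    of positive words. *)
Let annihilated (D : 'M[R]_n) := forall w c, positive_word w ->
  \tr (flow w *m D *m flow_inv w *m field_of c) = 0.

(** Starting the trajectory with a segment [(c, t)], that is, putting it last in the word, replaces
    [D] by [exp(tF) D exp(-tF)], whose derivative at [t = 0] is [[F, D]]. *)
Let annihilated_bracket D c : annihilated D ->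
  annihilated (comm_bracket (field_of c) D).
Proof.
move=> ND w c' pw; pose F := field_of c.
pose X t := flow w *m (expmx F t *m D *m expmx F (- t)) *m (flow_inv w *m field_of c').
rewrite -mulmxA.
apply: (@mxtrace_derive_eq0 _ _ X) => [|t].
  have d1 := mx_deriveM (mx_derive_expmx F 0) (mx_derive_cst D 0).
  have d2 := mx_deriveM d1 (mx_derive_expmxN F 0).
  have d3 := mx_deriveM (mx_derive_cst (flow w) 0) d2.
  have := mx_deriveM d3 (mx_derive_cst (flow_inv w *m field_of c') 0).
  rewrite oppr0 expmx0 !(mulmx1, mul1mx, mulmx0, mul0mx, addr0, add0r).
  by rewrite mulmxN.
rewrite le_eqVlt => /predU1P[<-|t0].
  by rewrite /X oppr0 expmx0 mulmx1 mul1mx mulmxA ND.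
have := ND (w ++ [:: (c, t)]) c'.
rewrite /positive_word all_cat -/(positive_word w) pw /= t0 => /(_ isT).
by rewrite flow_cat flow_inv_cat /= mulmx1 mul1mx /X !mulmxA.
Qed.

Let annihilated_add D1 D2 : annihilated D1 -> annihilated D2 -> annihilated (D1 + D2).
Proof.
move=> N1 N2 w c pw; rewrite (mulmxDr (flow w)) !mulmxDl mxtraceD.
by rewrite N1// N2// addr0.
Qed.

Let annihilated_scale a D : annihilated D -> annihilated (a *: D).
Proof.
by move=> N1 w c pw; rewrite -scalemxAr -!scalemxAl mxtraceZ N1// mulr0.
Qed.

(** Stability of the annihilator under [ad Y] is carried along with orthogonality, so that brackets
    can be handled by [tr (D [Y, Z]) = - tr ([Y, D] Z)]. *)
Let annihilator_lie (Y : 'M[R]_n) := forall D, annihilated D ->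
  \tr (D *m Y) = 0 /\ annihilated (comm_bracket Y D).

Let annihilator_lieP : lie_closed annihilator_lie.
Proof.
split=> [Y Z LY LZ|a Y LY|Y Z LY LZ] D ND.
- have [tY nY] := LY _ ND; have [tZ nZ] := LZ _ ND; split.
    by rewrite mulmxDr mxtraceD tY tZ addr0.
  have -> : comm_bracket (Y + Z) D = comm_bracket Y D + comm_bracket Z D.
    by rewrite /comm_bracket mulmxDl mulmxDr opprD addrACA.
  exact: annihilated_add.
- have [tY nY] := LY _ ND; split.
    by rewrite -scalemxAr mxtraceZ tY mulr0.
  have -> : comm_bracket (a *: Y) D = a *: comm_bracket Y D.
    by rewrite /comm_bracket -scalemxAl -scalemxAr scalerBr.
  exact: annihilated_scale.
- have [_ nY] := LY _ ND; have [_ nZ] := LZ _ ND; split.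
    have [+ _] := LZ _ nY.
    rewrite /comm_bracket mulmxBl mulmxBr !linearB /= => h.
    by apply/eqP; rewrite -oppr_eq0 opprB -h mulmxA mxtrace_mulC !mulmxA.
  (* Jacobi identity. *)
  have -> : comm_bracket (comm_bracket Y Z) D =
      comm_bracket Y (comm_bracket Z D) + (-1) *: comm_bracket Z (comm_bracket Y D).
    rewrite /comm_bracket scaleN1r !(mulmxBl, mulmxBr) !mulmxA.

    move: (Y *m Z *m D) (Z *m Y *m D) (D *m Y *m Z) (D *m Z *m Y) (Y *m D *m Z)
      (Z *m D *m Y) => a1 a2 a3 a4 a5 a6.
    by apply/matrixP => i j; rewrite !mxE; ring.
  apply: annihilated_add; last apply: annihilated_scale.
    by case: (LY _ nZ).
  by case: (LZ _ nY).
Qed.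

Hypothesis generating : forall L : 'M[R]_n -> Prop, lie_closed L ->
  L B0 -> (forall k, L (B k)) -> forall M, L M.

Let annihilated_eq0 D : annihilated D -> D = 0.
Proof.
have Lf c : annihilator_lie (field_of c).
  move=> D' ND; split; last exact: annihilated_bracket.
  by have := ND [::] c isT; rewrite /= mulmx1 mul1mx.
have [La Ls _] := annihilator_lieP.
have L0 : annihilator_lie B0.
  have := Lf (fun=> 0); rewrite /field_of big1 ?addr0// => k _.
  by rewrite scale0r.
have Lall : forall Y, annihilator_lie Y.
  apply: generating => // k.
  (* A control matrix is the difference of the fields for a unit control and for the zero
     control. *)
  have -> : B k = field_of (fun l => (l == k)%:R) + (-1) *: B0.
    rewrite /field_of (bigD1 k)//= eqxx scale1r big1 ?addr0 => [|l lk].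
      by rewrite scaleN1r addrC addKr.
    by rewrite (negbTE lk) scale0r.
  by apply: La => //; apply: Ls.
move=> ND; apply/matrixP => i j; rewrite mxE.
have [+ _] := Lall (delta_mx j i) _ ND.
rewrite /mxtrace (bigD1 i)//= mul_delta_mxE eqxx mulr1 big1 ?addr0// => a ai.
by rewrite mul_delta_mxE (negbTE ai) mulr0.
Qed.

(* As long as the directions of [w] do not span, some matrix [D] annihilates
   them; transported by the flow it is nonzero, so some extension of [w] has a
   direction that is not annihilated by [D]. *)
Lemma exists_spanning_word :
  exists2 w, positive_word w & <<flow_directions w>>%VS = fullv.
Proof.
apply/not_exists2P => nospan.
have grow k : exists2 w, positive_word w & (k <= \dim <<flow_directions w>>)%N.
  elim: k => [|k [w pw kw]]; first by exists [::].
  have Uf : <<flow_directions w>>%VS != fullv.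
    by apply/eqP; case: (nospan w).
  have [D D0 DU] := exists_trace_annihilator Uf.
  pose D' := flow w *m D *m flow_inv w.
  have D'0 : D' != 0.
    apply: contraNN D0 => /eqP D'E.
    have : flow_inv w *m D' *m flow w = D.
      by rewrite /D' !mulmxA flowK mul1mx -mulmxA flowK mulmx1.
    by rewrite D'E mulmx0 mul0mx => <-.
  have : ~ annihilated D' by move=> /annihilated_eq0/eqP; rewrite (negbTE D'0).
  move=> /existsNP[w2 /existsNP[c /not_implyP[pw2 tr0]]].
  (* The new direction depends only on [c] and the word before it; any positive duration would
     serve. *)
  exists ((c, 1) :: w2 ++ w); first by rewrite /positive_word /=
    ltr01 all_cat /=; apply/andP.
  set U' := <<_>>%VS; apply: (leq_ltn_trans kw).
  have UU' : (<<flow_directions w>> <= U')%VS.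
    apply: sub_span => x xw; rewrite /= inE; apply/orP; right.
    exact: flow_directions_suffix.
  rewrite (ltn_leqif (dimv_leqif_sup UU')); apply/negP => U'U.
  apply: tr0; rewrite -(DU (flow_inv (w2 ++ w) *m field_of c *m flow (w2 ++ w))).
    by rewrite [in RHS]mulmxA [RHS]mxtrace_mulC /D' flow_cat flow_inv_cat !mulmxA.
  by apply: (subvP U'U); apply: memv_span; rewrite /= inE eqxx.
have [w _] := grow (\dim {:'M[R]_n}).+1.
by rewrite ltnNge dimvS// subvf.
Qed.

End ControlWords.

(** * Concatenation of controls and reachability of flows *)

Lemma path_lt_le_last (R : numDomainType) (a : R) p : path <%R a p -> a <= last a p.
Proof.
elim: p a => //= b p IH a /andP[ab /IH]; exact: le_trans (ltW ab).
Qed.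

Lemma zip_path_le_last (R : numDomainType) (a : R) p ab :
  path <%R a p -> ab \in zip (a :: p) p -> ab.2 <= last a p.
Proof.
elim: p a => //= b p IH a /andP[_ bp]; rewrite inE => /predU1P[->|].
  exact: path_lt_le_last.
exact: IH.
Qed.

Lemma mem_zip_rcons (T : eqType) (a x : T) p ab :
  ab \in zip (a :: rcons p x) (rcons p x) ->
  ab \in zip (a :: p) p \/ ab = (last a p, x).
Proof.
elim: p a => [|b p IH] a /=; first by rewrite inE => /eqP ->; right.
rewrite inE => /predU1P[->|/IH[h|->]]; first by left; rewrite inE eqxx.
  by left; rewrite inE h orbT.
by right.
Qed.

Section Reachability.
Context {R : realType} {n m : nat} (B0 : 'M[R]_n) (B : 'I_m -> 'M[R]_n).

Lemma within_eq_continuous (A : set R) (f g : R -> R) :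
  (forall s, A s -> f s = g s) ->
  {within A, continuous f} -> {within A, continuous g}.
Proof.
by move=> fg; apply: subspace_eq_continuous => s; rewrite inE; exact: fg.
Qed.

Lemma reachable_id : reachable B0 B 1%:M.
Proof.
exists 0, (fun _ _ => 0), (fun=> 1%:M); split=> //; split; first by exists [::].
split=> //; split=> //; split=> [i j|]; first exact/continuous_subspaceT/cst_continuous.
by exists [::] => t /andP[t0 /(lt_trans t0)]; rewrite ltxx.
Qed.

Lemma mx_derive_expmx_shift (F Y : 'M[R]_n) T s :
  mx_derive (fun s => expmx F (s - T) *m Y) s (F *m (expmx F (s - T) *m Y)).
Proof.
have dD : is_derive s (1 : R) (fun t : R => t - T) 1 by exact: is_derive_shift.
have := mx_deriveM
  (@mx_derive_comp _ _ _ (fun t => t - T) s _ _ (mx_derive_expmx F (s - T)) dD)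
  (mx_derive_cst Y s).
by rewrite scale1r mulmx0 addr0 mulmxA.
Qed.

Lemma mx_derive_continuous (X : R -> 'M[R]_n) dX : (forall s, mx_derive X s (dX s)) ->
  forall i j, continuous (fun s => X s i j).
Proof.
move=> hX i j s; apply/differentiable_continuous/derivable1_diffP.
by case: (hX s i j).
Qed.

(** The control and trajectory up to [T] are extended by the constant control [c] and the
    exponential curve starting at [Y]. *)
Lemma reachable_step c t Y : 0 < t -> reachable B0 B Y ->
  reachable B0 B (expmx (field_of B0 B c) t *m Y).
Proof.
move=> t0 [T [u [X [T0 [[p [pp [pT pu]]] [[X0 [Xc [F XF]]] XT]]]]]].
pose G := field_of B0 B c; pose Z s := expmx G (s - T) *m Y.
exists (T + t), (fun s => if s < T then u s else c),
  (fun s => if s <= T then X s else Z s).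
split; first by rewrite addr_ge0// ltW.
split; last split; last first.
- by rewrite -[leRHS]addr0 lerD2l leNgt t0 /= /Z addrC addKr.
- split; first by rewrite T0.
  split=> [i j|].
    have -> : `[0, T + t] = `[0, T] `|` `[T, T + t] :> set R.
      apply/seteqP; split=> s /=; rewrite !in_itv /=; last first.
        by case=> /andP[h1 h2]; apply/andP; split; lra.
      by move=> /andP[h1 h2]; have [?|?] := leP s T; [left|right]; lra.
    apply: withinU_continuous; [exact: itv_closed|exact: itv_closed| |].
      apply: (within_eq_continuous _ (Xc i j)) => s.
      by rewrite /= in_itv /= => /andP[_ ->].
    apply: (@within_eq_continuous _ (fun s => Z s i j)).
      move=> s; rewrite /= in_itv /= => /andP[Ts _]; case: ifPn => // sT.
      have -> : s = T by apply/eqP; rewrite eq_le Ts sT.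
      by rewrite /Z subrr expmx0 mul1mx XT.
    apply: continuous_subspaceT.
    exact: (mx_derive_continuous (mx_derive_expmx_shift G Y T)).
  (* The junction time joins the exceptional set, since the velocity may jump there. *)
  exists (T :: F) => s /andP[s0 sTt]; rewrite inE negb_or => /andP[sT sF] i j.
  have [sltT|Tlts|/eqP] := ltgtP s T; last by rewrite (negbTE sT).
    apply: (near_eq_is_derive _ (XF s _ sF i j)); last by rewrite s0.
    by near=> r; rewrite ifT// ltW//; near: r; exact: lt_nbhsl.
  apply: (near_eq_is_derive _ (mx_derive_expmx_shift G Y T s i j)).
  near=> r; rewrite ifF//; apply/negbTE; rewrite -ltNge.
  by near: r; exact: lt_nbhsr.
exists (rcons p (T + t)); split; first by rewrite rcons_path pp pT /= ltrDl.
split; first by rewrite last_rcons.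
move=> ab /mem_zip_rcons[abp|->].
  have [g [gc gu]] := pu _ abp; exists g; split=> // s /[dup] sab /andP[_ sb] k.
  have := zip_path_le_last pp abp; rewrite pT => /(lt_le_trans sb) ->.
  exact: gu.
exists (fun k _ => c k); split=> [k|s /=]; first exact: cst_continuous.
by rewrite pT => /andP[/ltW Ts _] k; rewrite ltNge Ts.
Unshelve. all: by end_near. Qed.

Lemma reachable_flow w : positive_word w -> reachable B0 B (flow B0 B w).
Proof.
elim: w => [|a w IH] /=; first by move=> _; exact: reachable_id.
by move=> /andP[a0 /IH]; apply: reachable_step.
Qed.

End Reachability.

(** * Calculus of strict derivatives at the origin *)

Section StrictDerivative.
Context {R : realType} {V : normedModType R}.
Implicit Types (f g L : V -> R).

Definition bounded_functional L :=
  [/\ forall x y, L (x - y) = L x - L y &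
      exists2 C, 0 <= C & forall h, `|L h| <= C * `|h|].

(* Strict differentiability at the origin: the estimate is uniform in both
   arguments, which is what makes the contraction argument work. *)
Definition strict_derive0 f L :=
  bounded_functional L /\
  forall e, 0 < e -> exists2 d, 0 < d & forall x y, `|x| < d -> `|y| < d ->
    `|f x - f y - L (x - y)| <= e * `|x - y|.

Lemma strict_derive0_cst (a : R) : strict_derive0 (fun=> a) (fun=> 0).
Proof.
split; first by split=> [x y|]; [rewrite subrr|exists 0 => // h; rewrite normr0 mul0r].
move=> e e0; exists 1 => // x y _ _; rewrite subrr subr0 normr0.
by rewrite mulr_ge0// ltW.
Qed.

Lemma bounded_functionalD L1 L2 : bounded_functional L1 -> bounded_functional L2 ->
  bounded_functional (fun h => L1 h + L2 h).
Proof.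
move=> [a1 [C1 C10 b1]] [a2 [C2 C20 b2]]; split=> [x y|].
  by rewrite a1 a2 opprD addrACA.
exists (C1 + C2) => [|h]; first exact: addr_ge0.
by rewrite mulrDl (le_trans (ler_normD _ _))// lerD.
Qed.

Lemma bounded_functionalZ a L : bounded_functional L ->
  bounded_functional (fun h => a * L h).
Proof.
move=> [aL [C C0 b]]; split=> [x y|]; first by rewrite aL mulrBr.
exists (`|a| * C) => [|h]; first exact: mulr_ge0.
by rewrite normrM -mulrA ler_wpM2l.
Qed.

Lemma strict_derive0D f g Lf Lg : strict_derive0 f Lf -> strict_derive0 g Lg ->
  strict_derive0 (fun x => f x + g x) (fun h => Lf h + Lg h).
Proof.
move=> [bf hf] [bg hg]; split; first exact: bounded_functionalD.
move=> e e0; have e20 : 0 < e / 2 by rewrite divr_gt0.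
have [d1 d10 h1] := hf _ e20; have [d2 d20 h2] := hg _ e20.
exists (Num.min d1 d2); first by rewrite lt_min d10.
move=> x y; rewrite !lt_min => /andP[x1 x2] /andP[y1 y2].
have -> : f x + g x - (f y + g y) - (Lf (x - y) + Lg (x - y)) =
  (f x - f y - Lf (x - y)) + (g x - g y - Lg (x - y)) by ring.
by rewrite (le_trans (ler_normD _ _))// (splitr e) mulrDl lerD ?h1 ?h2.
Qed.

Lemma strict_derive0_sum (I : Type) (r : seq I) (f L : I -> V -> R) :
  (forall i, strict_derive0 (f i) (L i)) ->
  strict_derive0 (fun x => \sum_(i <- r) f i x) (fun h => \sum_(i <- r) L i h).
Proof.
move=> fL; elim: r => [|i r IH].
  under eq_fun do rewrite big_nil.
  under [X in strict_derive0 _ X]eq_fun do rewrite big_nil.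
  exact: strict_derive0_cst.
under eq_fun do rewrite big_cons.
under [X in strict_derive0 _ X]eq_fun do rewrite big_cons.
exact: strict_derive0D.
Qed.

Lemma strict_derive0_lipschitz f L : strict_derive0 f L ->
  exists2 K, 0 <= K & exists2 d, 0 < d & forall x y, `|x| < d -> `|y| < d ->
    `|f x - f y| <= K * `|x - y|.
Proof.
move=> [[_ [C C0 bL]] /(_ 1 ltr01)[d d0 hd]].
exists (1 + C); first by rewrite addr_ge0.
exists d => // x y xd yd; rewrite mulrDl.
have -> : f x - f y = (f x - f y - L (x - y)) + L (x - y) by rewrite subrK.
by rewrite (le_trans (ler_normD _ _))// lerD// hd.
Qed.

Lemma strict_derive0M f g Lf Lg : strict_derive0 f Lf -> strict_derive0 g Lg ->
  strict_derive0 (fun x => f x * g x) (fun h => f 0 * Lg h + g 0 * Lf h).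
Proof.
move=> sf sg; have [bf hf] := sf; have [bg hg] := sg.
split; first by apply: bounded_functionalD; exact: bounded_functionalZ.
move=> e e0.
have [Kf Kf0 [df df0 lf]] := strict_derive0_lipschitz sf.
have [Kg Kg0 [dg dg0 lg]] := strict_derive0_lipschitz sg.
have [_ [Cf Cf0 bLf]] := bf; have [_ [Cg Cg0 bLg]] := bg.
(* The four summands of [S] bound, up to the factor [eta * |x - y|], the four terms into which the
   error of the product is split below; the 1 in [S + 1] keeps the denominator positive. *)
pose S := (`|f 0| + Kf) + Kf * Cg + (`|g 0| + Kg) + Kg * Cf.
have S0 : 0 <= S by rewrite !addr_ge0// mulr_ge0.
pose eta := e / (S + 1).
have eta0 : 0 < eta by rewrite divr_gt0// ltr_wpDl.
have [d1 d10 h1] := hf _ eta0; have [d2 d20 h2] := hg _ eta0.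
(* Radius at most 1 bounds [f x] and [g y]; radius at most [eta] makes the products of two
   increments small. *)
exists (Num.min (Num.min (Num.min df dg) (Num.min d1 d2)) (Num.min 1 eta)).
  by rewrite !lt_min df0 dg0 d10 d20 ltr01 eta0.
move=> x y; rewrite !lt_min => /andP[/andP[/andP[xf xg] /andP[x1 x2]] /andP[x3 x4]].
move=> /andP[/andP[/andP[yf yg] /andP[y1 y2]] /andP[y3 y4]].
set h := `|x - y|; have h0 : 0 <= h by exact: normr_ge0.
have -> : f x * g x - f y * g y - (f 0 * Lg (x - y) + g 0 * Lf (x - y)) =
  f x * (g x - g y - Lg (x - y)) + (f x - f 0) * Lg (x - y) +
  g y * (f x - f y - Lf (x - y)) + (g y - g 0) * Lf (x - y) by ring.
have fx0 : `|f x - f 0| <= Kf * `|x| by rewrite -{2}[x]subr0 lf// normr0.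
have gy0 : `|g y - g 0| <= Kg * `|y| by rewrite -{2}[y]subr0 lg// normr0.
have fxb : `|f x| <= `|f 0| + Kf.
  rewrite -[f x](subrK (f 0)) addrC (le_trans (ler_normD _ _))// lerD2l.
  by rewrite (le_trans fx0)// ler_piMr// ltW.
have gyb : `|g y| <= `|g 0| + Kg.
  rewrite -[g y](subrK (g 0)) addrC (le_trans (ler_normD _ _))// lerD2l.
  by rewrite (le_trans gy0)// ler_piMr// ltW.
apply: (@le_trans _ _ (S * (eta * h))); last first.
  rewrite mulrA ler_wpM2r// /eta mulrCA ler_piMr ?(ltW e0)//.
  by rewrite ler_pdivrMr ?mul1r ?lerDl// ltr_wpDl.
have -> : S * (eta * h) = (`|f 0| + Kf) * (eta * h) + Kf * Cg * (eta * h) +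
  (`|g 0| + Kg) * (eta * h) + Kg * Cf * (eta * h) by rewrite /S; ring.
have product_bound a b K C z : `|a| <= K * `|z| -> `|b| <= C * h -> `|z| < eta ->
    0 <= K -> `|a * b| <= K * C * (eta * h).
  move=> aK bC ze K0; rewrite normrM mulrACA ler_pM//.
  by rewrite (le_trans aK)// ler_wpM2l// ltW.
apply: (le_trans (ler_normD _ _)); apply: lerD; last exact: product_bound gy0 _ _ _.
apply: (le_trans (ler_normD _ _)); apply: lerD; last by rewrite normrM ler_pM// h1.
apply: (le_trans (ler_normD _ _)); apply: lerD; last exact: product_bound fx0 _ _ _.
by rewrite normrM ler_pM// h2.
Qed.

(** The mean value theorem writes the increment of [e] with a derivative at an intermediate point,
    which continuity of [de] at [t] compares to [de t]. *)
Lemma strict_derive0_comp (e de : R -> R) (t : R) (k : V -> R) :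
  (forall s, is_derive s (1 : R) e (de s)) -> {for t, continuous de} ->
  bounded_functional k ->
  strict_derive0 (fun x => e (t + k x)) (fun h => de t * k h).
Proof.
move=> hde cde bk; split; first exact: bounded_functionalZ.
have [ak [C C0 bC]] := bk.
have k0 : k 0 = 0 by rewrite -(subrr 0) ak subrr.
have ce : continuous e.
  by move=> s; apply/differentiable_continuous/derivable1_diffP; case: (hde s).
move=> eps eps0; have C1 : 0 < C + 1 by rewrite ltr_wpDl.
have /cvgrPdist_lt/(_ (eps / (C + 1))) := cde.
rewrite divr_gt0// => /(_ isT) /nbhs_ballP[d /= d0 hd].
exists (d / (C + 1)); first by rewrite divr_gt0.
have kd z : `|z| < d / (C + 1) -> `|k z| < d.
  move=> zd; apply: (le_lt_trans (bC z)).
  apply: (@le_lt_trans _ _ ((C + 1) * `|z|)); first by rewrite ler_wpM2r// lerDl.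
  by rewrite mulrC -ltr_pdivlMr.
move=> x y /kd xd /kd yd.
have mvt a b : `|a| < d -> `|b| < d ->
    `|e (t + b) - e (t + a) - de t * (b - a)| <= eps / (C + 1) * `|b - a|.
  wlog ab : a b / a <= b => [hw|] ad bd.
    have [|/ltW ba] := leP a b; first by move=> ab; exact: hw.
    rewrite (distrC b a); have := hw b a ba bd ad; congr (_ <= _).
    by rewrite -normrN; congr (`|_|); ring.
  have le_tab : t + a <= t + b by rewrite lerD2l.
  have [|c cab ->] := MVT_segment le_tab (fun s _ => hde s).
    exact: continuous_subspaceT.
  have -> : t + b - (t + a) = b - a by ring.
  rewrite -mulrBl normrM ler_wpM2r// ltW// distrC hd//.
  move: cab; rewrite in_itv /= /ball /= => /andP[ca cb].
  rewrite ltr_norml; move: ad bd; rewrite !ltr_norml => /andP[? ?] /andP[? ?].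
  by apply/andP; split; lra.
have := mvt (k y) (k x) yd xd; rewrite -ak => /le_trans; apply.
apply: (@le_trans _ _ (eps / (C + 1) * ((C + 1) * `|x - y|))).
  rewrite ler_wpM2l ?divr_ge0 ?(ltW eps0) ?(ltW C1)//.
  by rewrite (le_trans (bC _))// ler_wpM2r// lerDl.
by rewrite mulrA divfK// gt_eqF.
Qed.

End StrictDerivative.

(** * The entrywise sup norm and local surjectivity *)

Section MatrixNorm.
Context {R : realType} {n : nat}.
Implicit Type A : 'M[R]_n.

Lemma mx_norm_leP A (a : R) : 0 <= a ->
  (forall i j, `|A i j| <= a) <-> `|A| <= a.
Proof.
move=> a0; rewrite [`|A|]mx_normrE; split=> [h|/bigmax_leP[_ h] i j].
  by apply/bigmax_leP; split=> // ij _; exact: h.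
exact: (h (i, j)).
Qed.

Lemma mx_norm_entry A i j : `|A i j| <= `|A|.
Proof. by move: i j; apply/mx_norm_leP. Qed.

Lemma bounded_functional_linear (phi : {linear 'M[R]_n -> R^o}) :
  bounded_functional (phi : 'M[R]_n -> R).
Proof.
split=> [x y|]; first exact: linearB.
exists (\sum_i \sum_j `|phi (delta_mx i j)|).
  by apply: sumr_ge0 => i _; apply: sumr_ge0.
move=> h; rewrite {1}(matrix_sum_delta h) linear_sum.
rewrite (le_trans (ler_norm_sum _ _ _))// mulr_suml; apply: ler_sum => i _.
rewrite linear_sum (le_trans (ler_norm_sum _ _ _))// mulr_suml.
apply: ler_sum => j _; rewrite linearZ normrM mulrC ler_wpM2l//.
exact: mx_norm_entry.
Qed.

End MatrixNorm.

HB.instance Definition _ (R : realType) m n := Complete.on 'M[R]_(m, n).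

(** A preimage of [Z] is a fixed point of [y + Z - G y], a contraction of ratio 1/2. The closed ball
    of radius [d / 2] is preserved because [d / 4 + (1/2)(d / 2) = d / 2]. *)
Lemma local_surjectivity (R : realType) n (G : 'M[R]_n -> 'M[R]_n) (d : R) :
  0 < d ->
  (forall x y, `|x| < d -> `|y| < d -> `|G x - G y - (x - y)| <= 2^-1 * `|x - y|) ->
  forall Z, `|Z - G 0| <= d / 4 -> exists2 y, `|y| < d & G y = Z.
Proof.
move=> d0 hG Z hZ; pose U : set 'M[R]_n := closed_ball_ Num.norm 0 (d / 2).
have UE y : U y = (`|y| <= d / 2) :> Prop by rewrite /U /closed_ball_ /= sub0r normrN.
have Ud y : U y -> `|y| < d by rewrite UE => yd; lra.
pose f y := y + Z - G y.
have fU : set_fun U U f.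
  move=> y Uy; rewrite UE.
  have -> : f y = (Z - G 0) - (G y - G 0 - (y - 0)).
    rewrite /f; move: (G y) (G 0) => gy g0.
    by apply/matrixP => i j; rewrite !mxE; ring.
  have := hG y 0 (Ud _ Uy); rewrite normr0 => /(_ d0); rewrite [in leRHS]subr0 => h.
  move: Uy; rewrite UE => Uy.
  by rewrite (le_trans (ler_normB _ _))//; lra.
pose F : {fun U >-> U} := mkfun fU.
have cF : is_contraction F.
  exists (2^-1)%:nng; split=> /=; first by rewrite invf_lt1// ltr1n.
  move=> [x y] [/= Ux Uy]; rewrite /f.
  have -> : x + Z - G x - (y + Z - G y) = - (G x - G y - (x - y)).
    move: (G x) (G y) => gx gy.
    by apply/matrixP => i j; rewrite !mxE; ring.
  by rewrite normrN hG//; exact: Ud.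
have [||y Uy yE] := banach_fixed_point cF.
- exact: closed_closed_ball_.
- by exists 0; rewrite UE normr0 divr_ge0// ltW.
exists y; first exact: Ud.
have /eqP : y = y + Z - G y := yE.
by rewrite -addrA -{1}[y]addr0 (inj_eq (addrI y)) eq_sym subr_eq0 => /eqP.
Qed.

(** * The endpoint map and its differential *)

Section EndpointMap.
Context {R : realType} {n m : nat} (B0 : 'M[R]_n) (B : 'I_m -> 'M[R]_n).
Implicit Types (w : @word R m) (k : nat -> 'M[R]_n -> R).

(** Durations are perturbed by functionals of a matrix, so that the endpoint map sends the matrix
    space to itself and can be compared with the identity. *)
Fixpoint shift_word k w (x : 'M[R]_n) : @word R m :=
  if w is a :: w' then
    (a.1, a.2 + k 0%N x) :: shift_word (fun l => k l.+1) w' x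
  else [::].

Lemma shift_word0 k w : (forall l, bounded_functional (k l)) ->
  shift_word k w 0 = w.
Proof.
elim: w k => //= -[c t] w IH k bk; rewrite IH//; congr ((_, _) :: _).
by have [ak _] := bk 0%N; rewrite -(subrr 0) ak subrr addr0.
Qed.

Lemma positive_shift_word k w : (forall l, bounded_functional (k l)) ->
  positive_word w ->
  exists2 d, 0 < d & forall x, `|x| < d -> positive_word (shift_word k w x).
Proof.
elim: w k => [|[c t] w IH] k bk /=; first by exists 1.
move=> /andP[t0 pw]; have [//|d d0 hd] := IH (fun l => k l.+1) _ pw.
have [_ [C C0 bC]] := bk 0%N; have C1 : 0 < C + 1 by rewrite ltr_wpDl.
exists (Num.min d (t / (C + 1))); first by rewrite lt_min d0 divr_gt0.
move=> x; rewrite lt_min ltr_pdivlMr// => /andP[xd xt]; rewrite hd// andbT.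
suff : `|k 0%N x| < t by rewrite ltr_norml => /andP[? _]; rewrite -ltrBlDl sub0r.
apply: (le_lt_trans (bC x)); rewrite mulrC; apply: le_lt_trans xt.
by rewrite ler_wpM2l// lerDl.
Qed.

(** Product rule by induction on the word. With [P = flow w] for the tail, the head contributes
    [F exp(tF) P = exp(tF) P (P^-1 F P)], the full flow times the first direction. *)
Lemma strict_derive0_flow k w : (forall l, bounded_functional (k l)) ->
  forall i j, strict_derive0 (fun x => flow B0 B (shift_word k w x) i j)
    (fun h => (flow B0 B w *m
      \sum_(l < size (flow_directions B0 B w))
        k l h *: (flow_directions B0 B w)`_l) i j).
Proof.
elim: w k => [|[c t] w IH] k bk i j /=.
  have -> : (fun h : 'M[R]_n => (1%:M *m \sum_(l < 0) k l h *: [::]`_l : 'M[R]_n) i j)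
      = fun=> 0.
    by apply/funext => h; rewrite big_ord0 mulmx0 mxE.
  exact: strict_derive0_cst.
set F := field_of B0 B c; pose k' l := k l.+1.
have bk' l : bounded_functional (k' l) by exact: bk.
pose S h : 'M[R]_n := \sum_(l < size (flow_directions B0 B w))
  k' l h *: (flow_directions B0 B w)`_l.
have dexp l : strict_derive0 (fun x : 'M[R]_n => expmx F (t + k 0%N x) i l)
    (fun h => (F *m expmx F t) i l * k 0%N h).
  apply: (@strict_derive0_comp _ _ (fun s => expmx F s i l)
    (fun s => (F *m expmx F s) i l) t (k 0%N) _ _ (bk 0%N)).
    by move=> s; exact: is_derive_expmx.
  exact: (mx_derive_continuous (fun s => mx_deriveM (mx_derive_cst F s)
    (mx_derive_expmx F s))).
have := strict_derive0_sum (index_enum 'I_n)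
  (fun l => strict_derive0M (dexp l) (IH k' bk' l j)).
have k00 : k 0%N 0 = 0 by have [ak _] := bk 0%N; rewrite -(subrr 0) ak subrr.
congr strict_derive0; apply/funext => h; first by rewrite mxE.
rewrite big_ord_recl -/(S h) mulmxDr -scalemxAr !mulmxA.
have -> : expmx F t *m flow B0 B w *m flow_inv B0 B w = expmx F t.
  by rewrite -mulmxA flow_invK mulmx1.
rewrite expmxC -(mulmxA (expmx F t)).
transitivity ((expmx F t *m (flow B0 B w *m S h)) i j +
    k 0%N h * (F *m expmx F t *m flow B0 B w) i j); last first.
  move: (expmx F t *m (flow B0 B w *m S h)) (F *m expmx F t *m flow B0 B w) => a b.
  by rewrite !mxE addrC.
rewrite [X in _ = X + _]mxE [X in _ = _ + _ * X]mxE mulr_sumr -big_split.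
apply: eq_bigr => l _ /=.
rewrite k00 addr0 shift_word0// -/(S h).
by congr (_ + _); rewrite mulrC mulrCA mulrA mulrC mulrA.
Qed.

Lemma accessible_of_generating :
  (forall L : 'M[R]_n -> Prop, lie_closed L ->
    L B0 -> (forall l, L (B l)) -> forall M, L M) ->
  accessible B0 B.
Proof.
move=> /exists_spanning_word[w pw spanw].
set X := flow_directions B0 B w in spanw.
(* Coordinates of [flow_inv w *m x] in the spanning directions: with these duration shifts the
   differential of the endpoint map at 0 is the identity. *)
pose phi (l : 'I_(size X)) : 'M[R]_n -> R :=
  fun x => coord (in_tuple X) l (flow_inv B0 B w *m x).
have bphi l : bounded_functional (phi l).
  exact: (bounded_functional_linear
    (coord (in_tuple X) l \o mulmx (flow_inv B0 B w))%FUN).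
pose k (l : nat) : 'M[R]_n -> R := if insub l is Some i then phi i else fun=> 0.
have bk l : bounded_functional (k l).
  rewrite /k; case: insubP => // _.
  by case: (strict_derive0_cst (V := 'M[R]_n) 0).
pose G x := flow B0 B (shift_word k w x).
have G0 : G 0 = flow B0 B w by rewrite /G shift_word0.
have dG i j : strict_derive0 (fun x => G x i j) (fun h => h i j).
  have := strict_derive0_flow w bk i j; congr strict_derive0.
  apply/funext => h; rewrite -/X.
  have -> : \sum_(l < size X) k l h *: X`_l = flow_inv B0 B w *m h.
    rewrite [RHS](coord_span (X := in_tuple X)) ?spanw ?memvf//.
    by apply: eq_bigr => l _; rewrite /k valK.
  by rewrite mulmxA flow_invK mul1mx.
have [d1 d10 hd1] := positive_shift_word bk pw.
have [d2 d20 hd2] : exists2 d, 0 < d & forall x y, `|x| < d -> `|y| < d ->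
    `|G x - G y - (x - y)| <= 2^-1 * `|x - y|.
  have half : 0 < 2^-1 :> R by rewrite invr_gt0.
  have dij (ij : 'I_n * 'I_n) := cid2 ((dG ij.1 ij.2).2 _ half).
  (* The norm is the maximum over entries, so the least of the entrywise radii works. *)
  exists (\big[Num.min/1]_ij s2val (dij ij)).
    by apply: lt_bigmin => // ij _; exact: (s2valP (dij ij)).
  move=> x y xd yd; apply/mx_norm_leP => [|i j]; first by rewrite mulr_ge0.
  have le_d := bigmin_le (1 : R) (i, j) (fun ij => s2val (dij ij) : R).
  have := s2valP' (dij (i, j)) x y (lt_le_trans xd le_d) (lt_le_trans yd le_d).
  by rewrite !mxE.
pose d := Num.min d1 d2.
have d0 : 0 < d by rewrite lt_min d10.
exists (flow B0 B w), (d / 4); split; first by rewrite divr_gt0.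
split; first exact: det_flow_gt0.
move=> Z hZ _.
have hd x y : `|x| < d -> `|y| < d -> `|G x - G y - (x - y)| <= 2^-1 * `|x - y|.
  by rewrite !lt_min => /andP[_ x2] /andP[_ y2]; exact: hd2.
have [|y yd <-] := local_surjectivity d0 hd (Z := Z).
  rewrite G0; apply/mx_norm_leP => [|i j]; first by rewrite divr_ge0// ltW.
  by rewrite !mxE ltW// hZ.
by apply: reachable_flow; apply: hd1; move: yd; rewrite lt_min => /andP[].
Qed.

End EndpointMap.

(** * Structural accessibility from the graph conditions *)

Theorem theorem2 (R : realType) (n d e : nat) (A : 'I_d -> 'M[R]_n)
    (arcs : 'I_e -> 'I_n * 'I_n) :
  (0 < n)%N -> (0 < d)%N ->
  weak_components_strong_ge2 (contr_graph arcs) ->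
  strongly_connected (union_rel (drift_graph A) (contr_graph arcs)) ->
  has_self_loop (contr_graph arcs) ->
  structurally_accessible [seq A s | s : 'I_d]
    [seq delta_mx (arcs k).1 (arcs k).2 | k : 'I_e].
Proof.
move=> _ _ [csym c2] conn [z czz]; set c := contr_graph arcs in csym c2 conn czz *.
have [l [l0 lA]] := generic_combination [seq A s | s : 'I_d].
set B0 := \sum_(g <- _) l g *: g in lA.
pose B (k : 'I_e) : 'M[R]_n := delta_mx (arcs k).1 (arcs k).2.
exists e, B0, B; split.
  (* The self-loop provides an arc, so there is at least one control. *)
  by case/existsP: czz => k _; exact: leq_ltn_trans (ltn_ord k).
split; first by exists l.
split=> [k|].
  exists (fun g => (g == B k)%:R); rewrite (bigD1_seq (B k)) ?undup_uniq//=.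
    by rewrite eqxx scale1r big1 ?addr0// => g /negbTE ->; rewrite scale0r.
  by rewrite mem_undup; apply/mapP; exists k; rewrite ?mem_enum.
have sub_sym i j : connect c i j -> connect (sym_rel c) i j.
  by apply: connect_sub => a b cab; apply: connect1; rewrite /sym_rel cab.
apply: accessible_of_generating => L LL L0 LB.
apply: (@lie_full _ _ L c B0 z LL) => //.
- by move=> i j /existsP[k /eqP kE]; have := LB k; rewrite /B kE.
(* The undirected connection can be reversed, and condition (i) makes it directed again. *)
- move=> i j /sub_sym cij; apply: csym.
  rewrite -[X in is_true X](connect_rev (sym_rel c)); apply: etrans cij.
  by apply: eq_connect => a b; rewrite /sym_rel orbC.
- by move=> i; have [j [ji cij]] := c2 i; exists j; [rewrite eq_sym|exact: csym].
- move=> i j; apply: connect_sub (conn i j) => a b.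
  rewrite /union_rel => /orP[/existsP[s As]|cab]; apply: connect1.
    by rewrite (lA (A s))//; apply/mapP; exists s; rewrite ?mem_enum.
  by rewrite cab orbT.
Qed.
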